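(* Let $i,j$ be integers with $0\leq i\leq j$ and $j\geq 1$, and let $G$ be a graph on $n$ vertices such that both $G$ and its complement $\bar G$ are connected. Then \[\gamma_{i/j}(G)+\gamma_{i/j}(\bar G)\leq \left\lceil \frac{i}{j}\left(\left\lfloor \frac{n}{2}\right\rfloor+2\right)\right\rceil+1.\]
   Context: All graphs are finite and simple; $\bar G$ is the complement of $G$. For a graph $G=(V,E)$ and $v\in V$, $N[v]=\{v\}\cup\{u : uv\in E\}$, and for $S\subseteq V$, $N[S]=\bigcup_{u\in S}N[u]$. For $p\in[0,1]$, a set $S\subseteq V$ is a $p$-dominating set if $|N[S]|/|V|\geq p$; $\gamma_p(G)$ is the minimum cardinality of a $p$-dominating set of $G$. *)

(* Defs.v *)
From HB Require Import structures.
From mathcomp Require Import all_boot all_order all_algebra.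

Set Implicit Arguments.
Unset Strict Implicit.
Unset Printing Implicit Defensive.

Import Order.TTheory GRing.Theory Num.Theory.
Local Open Scope ring_scope.

Record sgraph (V : finType) := SGraph {
  adj :> rel V;
  adj_sym : symmetric adj;
  adj_irr : irreflexive adj
}.

Section Graph.
Variables (V : finType) (G : sgraph V).

Definition compl_adj : rel V := [rel u v | (u != v) && ~~ G u v].

Lemma compl_adj_sym : symmetric compl_adj.
Proof. by move=> u v; rewrite /compl_adj /= eq_sym adj_sym. Qed.

Lemma compl_adj_irr : irreflexive compl_adj.
Proof. by move=> u; rewrite /compl_adj /= eqxx. Qed.

Definition compl : sgraph V := SGraph compl_adj_sym compl_adj_irr.

(* The graph with no vertices does not count as connected. *)
Definition connected_graph : Prop :=
  (0 < #|V|)%N /\ forall u v : V, connect G u v.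

Definition closed_nbhd (v : V) : {set V} := v |: [set u | G v u].

Definition closed_nbhds (S : {set V}) : {set V} :=
  \bigcup_(u in S) closed_nbhd u.

Variables (R : realFieldType) (p : R).

Definition p_dominating (S : {set V}) : bool :=
  p <= #|closed_nbhds S|%:R / #|V|%:R.

(* The seed [setT] of the minimisation is p-dominating as soon as p <= 1 and
   V is nonempty (see [gammaP]); outside that range the value is junk. *)
Definition gamma : nat :=
  #|[arg min_(S < [set: V] | p_dominating S) #|S|]|%N.

Lemma p_dominatingT : p <= 1 -> (0 < #|V|)%N -> p_dominating [set: V].
Proof.
move=> p1 V0; rewrite /p_dominating.
have -> : closed_nbhds [set: V] = [set: V].
  by apply/setP=> x; rewrite !inE; apply/bigcupP; exists x; rewrite ?inE ?eqxx.
by rewrite cardsT divff // pnatr_eq0 -lt0n.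
Qed.

Lemma gammaP : p <= 1 -> (0 < #|V|)%N ->
  (exists2 S, p_dominating S & #|S| = gamma) /\
  (forall S, p_dominating S -> (gamma <= #|S|)%N).
Proof.
move=> p1 V0; rewrite /gamma.
case: arg_minnP => [|S domS minS]; first exact: p_dominatingT.
by split=> //; exists S.
Qed.

End Graph.

(* Main.v *)
(* Write g, g' for the ordinary domination numbers of G and its complement.
   Keeping the ceil(p g) vertices of a minimum dominating set that are
   responsible for the most vertices gives gamma_p(G) <= ceil(p g), and likewise
   for the complement. So it suffices that g + g' <= n/2 + 2 (the slack +1 pays
   for adding two ceilings). For n > 1 connectedness forces g, g' >= 2, hence
   2 (g + g' - 2) <= g g', and g g' <= n by the Jaeger-Payan inequality. *)
Require Import Defs.
From HB Require Import structures.
From mathcomp Require Import all_boot all_order all_algebra.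
From mathcomp Require Import zify lra.

Set Implicit Arguments.
Unset Strict Implicit.
Unset Printing Implicit Defensive.

Import Order.TTheory GRing.Theory Num.Theory.
Local Open Scope ring_scope.

(** Deleting an element of least weight never lowers the average weight; the inequality compares
    averages with denominators cleared. *)
Lemma sub_sum_average (T : finType) (h : T -> nat) (D : {set T}) (m : nat) :
  (m <= #|D|)%N ->
  exists S : {set T}, [/\ S \subset D, #|S| = m &
    (m * \sum_(x in D) h x <= #|D| * \sum_(x in S) h x)%N].
Proof.
move=> le_mD; rewrite -(subKn le_mD); move: (leq_subr m #|D|).
elim: (#|D| - m)%N => [_|d IHd lt_dD]; first by exists D; rewrite subn0.
have [S [sSD cardS sumS]] := IHd (ltnW lt_dD).
have [x0 Sx0] : exists x, x \in S by apply/card_gt0P; rewrite cardS subn_gt0.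
case: (@arg_minnP _ x0 (mem S) h Sx0) => x /= Sx xmin.
have minS : (#|S| * h x <= \sum_(y in S) h y)%N.
  by rewrite -sum_nat_const; apply: leq_sum => y /xmin.
exists (S :\ x); split; first exact: subset_trans (subD1set _ _) sSD.
  by have := cardsD1 x S; rewrite Sx; lia.
move: sumS minS; rewrite [(\sum_(y in S) _)%N](big_setD1 x Sx) /= cardS.
have -> : (#|D| - d = (#|D| - d.+1).+1)%N by lia.
set k := (#|D| - d.+1)%N; set A := (\sum_(y in D) h y)%N.
set B := (\sum_(y in S :\ x) h y)%N => sumS minS.
(* The factor [k.+1], the size of [S], brings in [sumS]; then [k * h x <= B], from [minS], bounds
   [k * (h x + B)] by [k.+1 * B]. *)
rewrite -(leq_pmul2l (ltn0Sn k)).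
have := leq_mul (leqnn k) sumS; have := leq_mul (leqnn #|D|) minS; nia.
Qed.

Section Domination.
Variables (V : finType) (R : archiRealFieldType).
Implicit Type G : sgraph V.

Lemma mem_closed_nbhds G (S : {set V}) v :
  reflect (exists2 u, u \in S & v \in closed_nbhd G u)
          (v \in closed_nbhds G S).
Proof. exact: bigcupP. Qed.

Lemma mem_closed_nbhd G u v : (v \in closed_nbhd G u) = (v == u) || G u v.
Proof. by rewrite !inE. Qed.

Hypothesis V0 : (0 < #|V|)%N.

Lemma p_dominating1 G (S : {set V}) :
  p_dominating G (1 : R) S = (closed_nbhds G S == [set: V]).
Proof.
rewrite /p_dominating ler_pdivlMr ?ltr0n // mul1r ler_nat.
by rewrite eqEcard subsetT cardsT.
Qed.

(** Choosing one dominator per vertex replaces overlapping neighbourhoods by disjoint fibres, whose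
    sizes add up. *)
Lemma dominating_function G (S : {set V}) : closed_nbhds G S = [set: V] ->
  exists f : {ffun V -> V}, forall v, f v \in S /\ v \in closed_nbhd G (f v).
Proof.
move=> domS; have ex v : exists u, (u \in S) && (v \in closed_nbhd G u).
  have : v \in closed_nbhds G S by rewrite domS inE.
  by case/mem_closed_nbhds => u Su uv; exists u; rewrite Su.
exists [ffun v => xchoose (ex v)] => v; rewrite ffunE.
by apply/andP; exact: (xchooseP (ex v)).
Qed.

Lemma gamma_le_ceil G (p : R) : 0 <= p -> p <= 1 ->
  (gamma G p)%:Z <= Num.ceil (p * (gamma G (1 : R))%:R).
Proof.
move=> p0 p1; have [[D]] := gammaP G (lexx (1 : R)) V0.
rewrite p_dominating1 => /eqP /dominating_function [f fP] <- _.
have [_ gamma_min] := gammaP G p1 V0.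
have c0 : 0 <= Num.ceil (p * #|D|%:R).
  by rewrite -(ceil0 R) le_ceil ?mulr_ge0.
case ec: (Num.ceil (p * #|D|%:R)) c0 => [k|//] _.
have le_pk : p * #|D|%:R <= k%:R by have := ceil_ge (p * #|D|%:R); rewrite ec.
have le_kD : (k <= #|D|)%N.
  by rewrite -lez_nat -ec ceil_le_int ler_piMl.
pose h c := #|[set v | f v == c]|.
have sum_h (S : {set V}) : (\sum_(c in S) h c = #|[set v | f v \in S]|)%N.
  rewrite -sum1_card [RHS](partition_big f (mem S)) /=; last first.
    by move=> v; rewrite inE.
  apply: eq_bigr => c Sc; rewrite /h -sum1_card; apply: eq_bigl => v.
  by rewrite !inE; case: eqP => [->|]; rewrite ?Sc ?andbF.
have [S [_ cardS]] := sub_sum_average h le_kD; rewrite !sum_h.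
have -> : [set v | f v \in D] = [set: V].
  by apply/setP => v; rewrite !inE; case: (fP v).
rewrite cardsT lez_nat -cardS => avg; apply: gamma_min.
rewrite /p_dominating ler_pdivlMr ?ltr0n //.
have D0 : (0 < #|D|)%N.
  by have /card_gt0P [v _] := V0; apply/card_gt0P; exists (f v); case: (fP v).
have sub : (#|[set v | f v \in S]| <= #|closed_nbhds G S|)%N.
  apply/subset_leq_card/subsetP => v; rewrite inE => Sfv.
  by apply/mem_closed_nbhds; exists (f v); case: (fP v).
(* After scaling by [#|D|], the chain is [#|D| * p * #|V| <= k * #|V|], then [avg], then [sub]. *)
rewrite -(ler_pM2l (_ : 0 < #|D|%:R)) ?ltr0n //.
apply: le_trans (_ : (k * #|V|)%:R <= _).
  by rewrite mulrA [_ * p]mulrC natrM ler_wpM2r.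
by rewrite -natrM ler_nat -cardS (leq_trans avg) // leq_mul2l sub orbT.
Qed.

(* Jaeger and Payan. Among the partitions of V into gamma(G) classes, each
   inside some closed neighbourhood, take one with the most vertices complete to
   their own class. Each class must dominate the complement: a vertex x complete
   to a foreign class c either is complete to its own class too, so that the two
   classes merge and gamma(G) drops, or can be moved into c, which increases
   the count. *)
Lemma gamma_mul_compl_le G :
  (gamma G (1 : R) * gamma (compl G) (1 : R) <= #|V|)%N.
Proof.
have [[D]] := gammaP G (lexx (1 : R)) V0.
rewrite p_dominating1 => /eqP /dominating_function [f0 f0P] <- minD.
have [_ min_compl] := gammaP (compl G) (lexx (1 : R)) V0.
(* Elements of [D] serve only as labels: the centre [y] of a class is existential, since moving a
   vertex into a class may change its centre. *)
pose good (f : {ffun V -> V}) := [forall v, f v \in D] &&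
  [forall (c | c \in D), exists y, forall v,
     (f v == c) ==> (v \in closed_nbhd G y)].
pose complete (f : {ffun V -> V}) :=
  [set x | [forall y, (f y == f x) ==> (y \in closed_nbhd G x)]].
have good0 : good f0.
  apply/andP; split; first by apply/forallP => v; case: (f0P v).
  apply/forall_inP => c Dc; apply/existsP; exists c; apply/forallP => v.
  by apply/implyP => /eqP <-; case: (f0P v).
case: (@arg_maxnP _ f0 good (fun f => #|complete f|) good0) => f goodf maxf.
case/andP: (goodf) => /forallP fD /forall_inP fgood.
have class_dom c : c \in D ->
    (gamma (compl G) (1 : R) <= #|[set v | f v == c]|)%N.
  move=> Dc; apply: min_compl; rewrite p_dominating1; apply: contraT => ndom.
  have {ndom} [x xdom] : exists x, x \notin closed_nbhds (compl G) [set v | f v == c].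
    apply/existsP; rewrite -negb_forall; apply: contra ndom => /forallP all.
    by apply/eqP/setP => v; rewrite inE all.
  have adjx y : f y = c -> (y != x) && G x y.
    move=> fy; apply: contraR xdom => nG; apply/mem_closed_nbhds.
    exists y; first by rewrite inE fy.
    rewrite mem_closed_nbhd /= /compl_adj /= [x == y]eq_sym [G y x]adj_sym.
    by move: nG; case: (y == x) => /=.
  have fx : f x != c by apply/eqP => /adjx; rewrite eqxx.
  have [xcomp|xncomp] := boolP (x \in complete f).
    (* [g] picks a centre for each class; the default [x] is never reached on [D], by [fgood]. *)
    pose g d := odflt x [pick y | [forall v, (f v == d) ==> (v \in closed_nbhd G y)]].
    have gP v : v \in closed_nbhd G (g (f v)).
      rewrite /g; case: pickP => [y /forallP /(_ v)|no]; first by rewrite eqxx.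
      by have /existsP [y] := fgood _ (fD v); rewrite no.
    (* The single vertex [x] replaces the centres of both [c] and its own class. *)
    pose S := x |: [set g d | d in D :\ c :\ f x].
    have cardS : (#|S| < #|D|)%N.
      rewrite /S cardsU1 (cardsD1 c D) (cardsD1 (f x) (D :\ c)).
      rewrite Dc in_setD1 fx fD.
      have := leq_imset_card g (mem (D :\ c :\ f x)).
      by case: (x \notin _) => /=; set A := #|_|; set B := #|_|; lia.
    have := minD S; rewrite p_dominating1 leqNgt cardS => /(_ _)/negP [] //.
    apply/eqP/setP => v; rewrite inE; apply/mem_closed_nbhds.
    have [fvc|fvc] := eqVneq (f v) c.
      exists x; rewrite ?setU11 // mem_closed_nbhd.
      by have /andP[_ ->] := adjx v fvc; rewrite orbT.
    have [fvx|fvx] := eqVneq (f v) (f x).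
      exists x; rewrite ?setU11 //.
      by move: xcomp; rewrite inE => /forallP /(_ v); rewrite fvx eqxx.
    exists (g (f v)) => //; apply/setU1r/imset_f.
    by rewrite !inE fvx fvc fD.
  pose f' := [ffun v => if v == x then c else f v].
  have f'x : f' x = c by rewrite ffunE eqxx.
  have f'N v : v != x -> f' v = f v by rewrite ffunE => /negbTE ->.
  have nbx v : f' v = c -> v \in closed_nbhd G x.
    rewrite mem_closed_nbhd; have [//|vx] := eqVneq v x.
    by rewrite f'N // => /adjx /andP[].
  have goodf' : good f'.
    apply/andP; split.
      by apply/forallP => v; rewrite ffunE; case: ifP.
    apply/forall_inP => d Dd; have [->|dc] := eqVneq d c.
      by apply/existsP; exists x; apply/forallP => v; apply/implyP => /eqP/nbx.
    have /existsP [y /forallP yP] := fgood d Dd.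
    apply/existsP; exists y; apply/forallP => v; apply/implyP => /eqP fv.
    have vx : v != x.
      by apply: contraNneq dc => vx; rewrite -fv vx f'x.
    by have := yP v; rewrite -fv f'N // eqxx.
  have : (#|complete f| < #|complete f'|)%N.
    apply: proper_card; apply/properP; split; last first.
      exists x => //; rewrite inE; apply/forallP => v; apply/implyP => /eqP.
      by rewrite f'x => /nbx.
    apply/subsetP => w wf; have wx : w != x by apply: contraNneq xncomp => <-.
    move: wf; rewrite !inE => /forallP wP; apply/forallP => y; apply/implyP.
    rewrite (f'N w) //; have [->|yx] := eqVneq y x; last first.
      by rewrite f'N //; apply/implyP.
    (* Only class [c] gains a vertex, namely [x], and all old members of [c] are adjacent to it. *)
    rewrite f'x => /eqP/esym/adjx /andP[_].
    by rewrite mem_closed_nbhd adj_sym => ->; rewrite orbT.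
  by have := maxf _ goodf'; rewrite /= leqNgt => /negbTE->.
rewrite -sum_nat_const -cardsT -sum1_card [leqRHS](partition_big f (mem D)) //=.
apply: leq_sum => c /class_dom /leq_trans; apply.
by rewrite -sum1_card; apply: eq_leq; apply: eq_bigl => v; rewrite !inE.
Qed.

(** A vertex dominating [G] alone would be isolated in the complement. *)
Lemma gamma_ge2 G : (1 < #|V|)%N -> connected_graph (compl G) ->
  (1 < gamma G (1 : R))%N.
Proof.
move=> V1 [_ conn]; have [[D]] := gammaP G (lexx (1 : R)) V0.
rewrite p_dominating1 => /eqP domD <- _.
have nbD v : exists2 u, u \in D & v \in closed_nbhd G u.
  by apply/mem_closed_nbhds; rewrite domD inE.
have /card_gt0P [v0 _] := V0; have [u Du _] := nbD v0.
have [/card_le1_eqP D1|//] := leqP #|D| 1.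
have /card_gt1P [a [b [_ _ ab]]] := V1.
have [w wu] : exists w, w != u.
  by have [bu|bu] := eqVneq b u; [exists a; rewrite -bu | exists b].
have /connectP [[|z s] /= pth lst] := conn u w; first by rewrite lst eqxx in wu.
case/andP: pth => /andP[uz nuz] _; have [u' Du' zu'] := nbD z.
move: zu'; rewrite (D1 u u' Du Du') mem_closed_nbhd eq_sym (negbTE uz) /=.
by rewrite (negbTE nuz).
Qed.

End Domination.

Lemma gamma_add_compl_le (R : archiRealFieldType) (V : finType) (G : sgraph V) :
  connected_graph G -> connected_graph (compl G) ->
  (gamma G (1 : R) + gamma (compl G) (1 : R) <= #|V|./2 + 2)%N.
Proof.
move=> hG hGc; have [V0 _] := hG.
(* This allows [gamma_ge2] to be applied to [compl G]. *)
have hGcc : connected_graph (compl (compl G)).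
  split=> // u v; have [_ /(_ u v)] := hG; congr is_true; apply: eq_connect.
  move=> x y /=; rewrite /compl_adj /= negb_and !negbK andb_orr andNb /=.
  by case: eqVneq => //= ->; rewrite adj_irr.
(* On one vertex the lower bound 2 fails, but both numbers are at most 1. *)
have [V1|V1] := leqP #|V| 1.
  have bound (H : sgraph V) : (gamma H (1 : R) <= 1)%N.
    have [_ /(_ setT)] := gammaP H (lexx (1 : R)) V0.
    by rewrite cardsT => /(_ (p_dominatingT _ (lexx _) V0))/leq_trans; apply.
  by have := bound G; have := bound (compl G); lia.
have := gamma_mul_compl_le R V0 G.
have := gamma_ge2 R V0 V1 hGc; have := gamma_ge2 R V0 V1 hGcc.
set a := gamma G _; set b := gamma _ _ => b2 a2 ab.
(* This follows from [(a - 2) * (b - 2) >= 0]; integrality of [a + b] supplies the floor. *)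
suff : (2 * (a + b) <= #|V| + 4)%N by lia.
by nia.
Qed.

(** Each ceiling exceeds its argument by less than 1, so the left side is strictly below
    [Num.ceil (x + y) + 2], and both are integers. *)
Lemma ceilD_le (R : archiRealFieldType) (x y : R) :
  Num.ceil x + Num.ceil y <= Num.ceil (x + y) + 1.
Proof.
rewrite -ltzD1 -(ltr_int R) !rmorphD /=.
have := ceil_ge (x + y); have := ceilB1_lt x; have := ceilB1_lt y.
by rewrite !rmorphB /=; lra.
Qed.

Theorem theorem3p5 (i j : int) (hi : 0 <= i) (hij : i <= j) (hj : 1 <= j)
    (n : nat) (V : finType) (G : sgraph V) (hn : #|V| = n)
    (hG : connected_graph G) (hGc : connected_graph (compl G)) :
  (gamma G (i%:Q / j%:Q) + gamma (compl G) (i%:Q / j%:Q))%N%:Z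
    <= Num.ceil (i%:Q / j%:Q * (n./2 + 2)%N%:R) + 1.
Proof.
have j0 : 0 < j%:Q by rewrite ltr0z (lt_le_trans ltr01).
have p0 : 0 <= i%:Q / j%:Q by rewrite divr_ge0 ?ler0z // ltW.
have p1 : i%:Q / j%:Q <= 1 by rewrite ler_pdivrMr // mul1r ler_int.
have [V0 _] := hG; rewrite PoszD.
apply: le_trans (lerD (gamma_le_ceil V0 G p0 p1)
                      (gamma_le_ceil V0 (compl G) p0 p1)) _.
apply: le_trans (ceilD_le _ _) _; rewrite lerD2r le_ceil //.
rewrite -mulrDr -natrD ler_wpM2l // ler_nat -hn.
exact: gamma_add_compl_le.
Qed.
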